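(* For all integers $n\ge 0$ (with $c,q$ generic nonzero parameters), the even-odd $q$-Lommel polynomials $p_n(x;c,q)$ are the following limits of associated Askey--Wilson polynomials: $$p_{2n}(x;c,q)=\lim_{\alpha\to\infty}\frac{(2q)^n}{\alpha^{2n}}\,\psi_n^{(\alpha,2)}\!\left(\frac{\alpha^2x^2}{2q};\,q^{-1}\right)\quad\text{with } (A,B,C,D)=\left(\frac{\alpha}{cq},\frac1\alpha,\frac1\alpha,\frac1\alpha\right),$$ $$p_{2n+1}(x;c,q)=x\lim_{\alpha\to\infty}\frac{(2/(cq^2))^n}{\alpha^{2n}}\,\psi_n^{(\alpha,1)}\!\left(\frac{cq^2\alpha^2x^2}{2};\,q\right)\quad\text{with } (A,B,C,D)=\left(cq^2\alpha,\frac1\alpha,\frac1\alpha,\frac1\alpha\right).$$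
   Context: Notation: $(a;p)_n=\prod_{i=0}^{n-1}(1-ap^i)$ and $(a_1,\dots,a_r;p)_n=\prod_j(a_j;p)_n$. The even-odd $q$-Lommel polynomials are defined by $p_{-1}(x;c,q)=0$, $p_0(x;c,q)=1$, $p_{n+1}(x;c,q)=x\,p_n(x;c,q)-\lambda_n p_{n-1}(x;c,q)$ for $n\ge0$, where $\lambda_{2n}=\dfrac{cq^{3n-1}}{(1-cq^{2n-1})(1-cq^{2n})}$ and $\lambda_{2n+1}=\dfrac{q^n}{(1-cq^{2n})(1-cq^{2n+1})}$. The very-well-poised series in base $p$ is $${}_{10}W_9(u;e_1,\dots,e_7;p;T)=\sum_{s\ge0}\frac{1-up^{2s}}{1-u}\,\frac{(u,e_1,\dots,e_7;p)_s}{(p,up/e_1,\dots,up/e_7;p)_s}\,T^s .$$ The associated Askey--Wilson polynomials $\psi_n^{(\alpha,\epsilon)}(x;p)$, $\epsilon\in\{1,2\}$, with parameters $A,B,C,D$, association parameter $\alpha$ and base $p$ are the monic polynomials of degree $n$ in $x=\frac12(z+z^{-1})$ given by $$\psi_n^{(\alpha,\epsilon)}(x;p)=K_n\sum_{k=0}^n\frac{(p^{-n},ABCD\alpha^2p^{n-1},ABCD\alpha^2/p,Az,A/z;p)_k}{(p,AB\alpha,AC\alpha,AD\alpha,ABCD\alpha/p;p)_k}\,p^k\;W_k,$$ $$W_k={}_{10}W_9\!\left(ABCD\alpha^2p^{k-2};\,\alpha,\,BC\alpha/p,\,BD\alpha/p,\,CD\alpha/p,\,S,\,ABCD\alpha^2p^{n+k-1},\,p^{k-n};\,p;\,T\right),$$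 where $$K_n=(2A)^{-n}\frac{(AB\alpha,AC\alpha,AD\alpha,ABCD\alpha/p;p)_n}{(ABCD\alpha^2p^{n-1},ABCD\alpha^2/p;p)_n},$$ and $(S,T)=(p^{k+1},A^2)$ if $\epsilon=1$, $(S,T)=(p^k,pA^2)$ if $\epsilon=2$. The series $W_k$ terminates (it is a sum over $0\le s\le n-k$). When the base is $p=q^{-1}$, every $p$ in these formulas is replaced by $q^{-1}$, while the parameters $A,B,C,D$ are the specified ones. Limits are coefficientwise in $x$. *)

(* Defs.v *)
From mathcomp Require Import all_boot all_order all_algebra.
From mathcomp Require Import all_classical all_reals all_analysis.
From mathcomp Require Import ring.
Import Order.TTheory GRing.Theory Num.Theory.
Import numFieldNormedType.Exports.

Set Implicit Arguments.
Unset Strict Implicit.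
Unset Printing Implicit Defensive.

Local Open Scope classical_set_scope.
Local Open Scope ring_scope.

Section QSeries.
Variable K : fieldType.
Implicit Types (a p u T : K) (s es : seq K) (k n N : nat).

Definition qpoch a p n : K := \prod_(i < n) (1 - a * p ^+ i).

Definition qpochs s p n : K := \prod_(a <- s) qpoch a p n.

(* The sum over 0 <= s <= N of the very-well-poised series
   W(u; es; p; T); with seven entries in es it is a 10W9. *)
Definition vwp_sum N u es p T : K :=
  \sum_(s < N.+1)
    (1 - u * p ^+ (2 * s)) / (1 - u)
    * (qpochs (u :: es) p s / qpochs (p :: [seq u * p / e | e <- es]) p s)
    * T ^+ s.

End QSeries.

Section QLommel.
Variable K : fieldType.
Variables c q : K.

(* For j = 0 the exponent 3 * m - 1 is the integer -1, not a truncated 0. *)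
Definition lommel_lambda (j : nat) : K :=
  let m := j./2 in
  if odd j then q ^+ m / ((1 - c * q ^+ (2 * m)) * (1 - c * q ^+ (2 * m).+1))
  else c * q ^ ((3 * m)%:Z - 1)
       / ((1 - c * q ^ ((2 * m)%:Z - 1)) * (1 - c * q ^+ (2 * m))).

(* The pair (p_(n-1), p_n), starting from (p_(-1), p_0) = (0, 1). *)
Fixpoint qLommel_pair (n : nat) : {poly K} * {poly K} :=
  if n is m.+1 then
    let: (a, b) := qLommel_pair m in (b, 'X * b - lommel_lambda m *: a)
  else (0, 1).

Definition qLommel (n : nat) : {poly K} := (qLommel_pair n).2.

Lemma qLommel0 : qLommel 0 = 1.
Proof. by []. Qed.

Lemma qLommel1 : qLommel 1 = 'X.
Proof. by rewrite /qLommel /= mulr1 scaler0 subr0. Qed.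

Lemma qLommelSS n :
  qLommel n.+2 = 'X * qLommel n.+1 - lommel_lambda n.+1 *: qLommel n.
Proof. by rewrite /qLommel /=; case: (qLommel_pair n). Qed.

End QLommel.

Inductive aw_kind := Eps1 | Eps2.

Section AssociatedAskeyWilson.
Variable K : fieldType.
Variables (eps : aw_kind) (A B C D alpha p : K).

(* (A z, A / z; p)_k as a polynomial in x = (z + 1/z) / 2; see aw_basisE. *)
Definition aw_basis (k : nat) : {poly K} :=
  \prod_(i < k) ((1 + A ^+ 2 * p ^+ (2 * i))%:P - (2 * A * p ^+ i) *: 'X).

(* W_k; it terminates at s = n - k because of the parameter p ^ (k - n). *)
Definition aw_W (n k : nat) : K :=
  let: (S_, T) := match eps with
                 | Eps1 => (p ^+ k.+1, A ^+ 2)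
                 | Eps2 => (p ^+ k, p * A ^+ 2)
                 end in
  vwp_sum (n - k) (A * B * C * D * alpha ^+ 2 * p ^ (k%:Z - 2))
    [:: alpha; B * C * alpha / p; B * D * alpha / p; C * D * alpha / p; S_;
        A * B * C * D * alpha ^+ 2 * p ^ ((n + k)%:Z - 1);
        p ^ (k%:Z - n%:Z)]
    p T.

Definition aw_norm (n : nat) : K :=
  (2 * A) ^- n
  * (qpochs [:: A * B * alpha; A * C * alpha; A * D * alpha;
                A * B * C * D * alpha / p] p n
     / qpochs [:: A * B * C * D * alpha ^+ 2 * p ^ (n%:Z - 1);
                  A * B * C * D * alpha ^+ 2 / p] p n).

Definition assocAW (n : nat) : {poly K} :=
  aw_norm n *: \sum_(k < n.+1)
    (qpochs [:: p ^- n; A * B * C * D * alpha ^+ 2 * p ^ (n%:Z - 1);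
                A * B * C * D * alpha ^+ 2 / p] p k
     / qpochs [:: p; A * B * alpha; A * C * alpha; A * D * alpha;
                  A * B * C * D * alpha / p] p k
     * p ^+ k * aw_W n k) *: aw_basis k.

Lemma aw_basisE (k : nat) (z : K) : 2 != 0 :> K -> z != 0 ->
  (aw_basis k).[(z + z^-1) / 2] = qpoch (A * z) p k * qpoch (A / z) p k.
Proof.
move=> two0 z0; rewrite /aw_basis horner_prod -big_split /=.
apply: eq_bigr => i _.
rewrite hornerD hornerN hornerZ hornerC hornerX mulnC exprM.
by field; apply/andP.
Qed.

(* The defining formula at x = (z + 1/z) / 2, in terms of z. *)
Lemma assocAWE (n : nat) (z : K) : 2 != 0 :> K -> z != 0 ->
  (assocAW n).[(z + z^-1) / 2] =
  aw_norm n * \sum_(k < n.+1)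
    qpochs [:: p ^- n; A * B * C * D * alpha ^+ 2 * p ^ (n%:Z - 1);
               A * B * C * D * alpha ^+ 2 / p; A * z; A / z] p k
    / qpochs [:: p; A * B * alpha; A * C * alpha; A * D * alpha;
                 A * B * C * D * alpha / p] p k
    * p ^+ k * aw_W n k.
Proof.
move=> two0 z0; rewrite /assocAW hornerZ horner_sum; congr (_ * _).
apply: eq_bigr => k _; rewrite hornerZ aw_basisE //.
by rewrite /qpochs !big_cons !big_nil; ring.
Qed.

End AssociatedAskeyWilson.

Section Limits.
Variable K : numFieldType.

(* The filter of |a| -> oo; for K the complex numbers, the punctured
   neighbourhoods of the point at infinity of the Riemann sphere. *)
Definition norm_infty : set_system K :=
  [set P | \forall M \near +oo, forall a, M < `|a| -> P a].

Global Instance norm_infty_filter : ProperFilter norm_infty.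
Proof.
apply: Build_ProperFilter_ex.
  move=> P PI; near (pinfty_nbhs K) => M.
  have M0 : 0 < M by near: M; exact: nbhs_pinfty_gt.
  exists (M + 1); have : forall a, M < `|a| -> P a by near: M; exact: PI.
  by apply; rewrite gtr0_norm ?addr_gt0 // ltrDl.
split.
- by rewrite /norm_infty /=; near=> M.
- move=> P Q PI QI; rewrite /norm_infty /=; near=> M => a aM.
  by split; move: a aM; near: M; [exact: PI|exact: QI].
- move=> P Q PQ; rewrite /norm_infty /=; apply: filterS => M h a aM.
  exact/PQ/h.
Unshelve. all: by end_near. Qed.

Definition coef_cvg (F : set_system K) (f : K -> {poly K}) (L : {poly K}) :=
  forall i : nat, (f a)`_i @[a --> F] --> L`_i.

End Limits.

(* Main.v *)
Require Import Defs.
From mathcomp Require Import all_boot all_order all_algebra.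
From mathcomp Require Import all_classical all_reals all_analysis.
From mathcomp Require Import ring zify.
Import Order.TTheory GRing.Theory Num.Theory.
Import numFieldNormedType.Exports.
Local Open Scope classical_set_scope.
Local Open Scope ring_scope.

Set Implicit Arguments.
Unset Strict Implicit.
Unset Printing Implicit Defensive.

(** Both sides have the same explicit coefficients, namely prefactors times
    terminating 2phi1 series.

    On the Askey-Wilson side write A = beta alpha with beta constant.  Then
    A B C D alpha^2 = beta, and alpha occurs only in factorials of the form
    (x alpha; p)_k or (x / alpha; p)_k with x constant, and in explicit powers.
    As alpha grows, the former are asymptotic to alpha^k (-x)^k p^(k choose 2)
    and the latter tend to 1.  All the powers of alpha cancel, and the k-th
    basis polynomial contributes only its top monomial X^(2k).  So the limit
    exists, and its coefficient of X^(2k) is a product times the limit of W_k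
    ([cvg_assocAW], [cvg_aw_W]).

    Of the seven free parameters of W_k, one tends to infinity, three tend to
    0 and three are constant.  The effects of the first and of one of the small
    ones cancel, so that the limit is a terminating very-well-poised 8W7 in
    which two parameters have been sent to 0.  Watson's transformation, in
    that degenerate case, turns it into a 2phi1 ([watson_degenerate]).  The
    proof is Bailey's: expand the factors that contain one parameter by the
    q-Vandermonde sum ([qVandermonde]), exchange the two summations, and
    evaluate the inner sums by a degenerate 6phi5 sum ([vwp_sum_base]).  The
    transformation is what makes the even and the odd polynomials comparable:
    before it, the s-th terms of the two very-well-poised sums contain, in
    base q, the opposite quadratic powers q^(s (s - 1)) and q^(- s (s - 1));
    after it both are given by the single formula [lommel_coef].

    On the Lommel side, [lommel_coef] m D is the coefficient of X^D in
    p_(D + 2 m).  The three-term recurrence of the polynomials becomes a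
    contiguous relation between 2phi1 series which already holds term by term
    ([lommel_coefSS]), except for the constant terms, which are evaluated in
    closed form by q-Vandermonde ([lommel_coef_const]).  The odd polynomials
    come from base q directly; the even ones come from base 1/q, and are
    brought to base q by inverting the base in each factorial
    ([aw_limit_coef_even]). *)

(** * q-shifted factorials and q-binomial coefficients *)

Section QPochhammer.
Variable K : fieldType.
Implicit Types (a b d p : K) (j k m n s t : nat).

Lemma eq_of_multiple (R : comNzRingType) (k a b x y : R) :
  a = b -> x - y = k * (a - b) -> x = y.
Proof. by move=> ->; rewrite subrr mulr0 => /subr0_eq. Qed.

Lemma qpoch0 a p : qpoch a p 0 = 1.
Proof. by rewrite /qpoch big_ord0. Qed.

Lemma qpochS a p n : qpoch a p n.+1 = qpoch a p n * (1 - a * p ^+ n).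
Proof. by rewrite /qpoch big_ord_recr. Qed.

Lemma qpochD a p m n :
  qpoch a p (m + n) = qpoch a p m * qpoch (a * p ^+ m) p n.
Proof.
elim: n => [|n IHn]; first by rewrite addn0 qpoch0 mulr1.
by rewrite addnS !qpochS IHn exprD; ring.
Qed.

Lemma qpochSl a p n : qpoch a p n.+1 = (1 - a) * qpoch (a * p) p n.
Proof. by rewrite -add1n qpochD qpochS qpoch0 expr0 mulr1 mul1r expr1. Qed.

Lemma qpoch_neq0 a p n :
  (forall i, (i < n)%N -> a * p ^+ i != 1) -> qpoch a p n != 0.
Proof.
move=> aP; apply/prodf_neq0 => i _.
by rewrite subr_eq0 eq_sym aP.
Qed.

Lemma expr_bin2S p j : p ^+ 'C(j.+1, 2) = p ^+ 'C(j, 2) * p ^+ j.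
Proof. by rewrite binS bin1 exprD. Qed.

(** The Gaussian binomial [n, k] is given by its Pascal rule, so that it
    vanishes for k > n and makes sense for every p. *)
Fixpoint qbin p n k : K :=
  match n, k with
  | _, 0 => 1
  | 0, _.+1 => 0
  | n'.+1, k'.+1 => p ^+ k * qbin p n' k + qbin p n' k'
  end.

Lemma qbin0 p n : qbin p n 0 = 1. Proof. by case: n. Qed.

Lemma qbinS p n k :
  qbin p n.+1 k.+1 = p ^+ k.+1 * qbin p n k.+1 + qbin p n k.
Proof. by []. Qed.

Lemma qbin_small p n k : (n < k)%N -> qbin p n k = 0.
Proof.
elim: n k => [|n IHn] [|k] //; rewrite ltnS => nk.
by rewrite qbinS !IHn ?mulr0 ?addr0 // ltnW.
Qed.

(** The relation between neighbours in a row, multiplied by p^j to avoid the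
    truncated difference n - j. *)
Lemma qbin_step p n j :
  qbin p n j.+1 * (1 - p ^+ j.+1) * p ^+ j = qbin p n j * (p ^+ j - p ^+ n).
Proof.
elim: n j => [|n IHn] [|j].
- by rewrite qbin0 /=; ring.
- by rewrite /=; ring.
- rewrite qbinS !qbin0; move: (IHn 0%N).
  rewrite qbin0 !expr0 !expr1 !exprS => H.
  by apply: (eq_of_multiple (k := p) H); ring.
- rewrite !qbinS.
  have H1 := IHn j; have H2 := IHn j.+1.
  move: H1 H2; rewrite !exprS => H1 H2.
  apply: (eq_of_multiple (k := p) H1).
  apply: (eq_of_multiple (k := p * p ^+ j * p) H2); ring.
Qed.

(** The terminating factor of a hypergeometric series is a q-binomial; this
    is how the Pascal rule enters the summations below. *)
Lemma qpoch_negX p n j : p != 0 ->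
  qpoch (p ^- n) p j =
    (-1) ^+ j * p ^+ 'C(j, 2) / (p ^+ n) ^+ j * (qbin p n j * qpoch p p j).
Proof.
move=> p0; elim: j => [|j IHj].
  by rewrite !qpoch0 qbin0 bin_small // !expr0 invr1 !mulr1.
rewrite !qpochS {}IHj expr_bin2S.
have pn0 : p ^+ n != 0 by rewrite expf_neq0.
have pnj0 : (p ^+ n) ^+ j != 0 by rewrite expf_neq0.
have := qbin_step p n j; rewrite !exprS => H.
pose k := (-1) ^+ j * p ^+ 'C(j, 2) / (p ^+ n) ^+ j.+1 * qpoch p p j.
apply: (eq_of_multiple (k := k) H).
by rewrite /k exprS; field; rewrite pnj0 pn0.
Qed.

Lemma qbin_fact p m k :
  (forall i, (0 < i)%N -> p ^+ i != 1) -> p != 0 ->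
  qbin p (m + k) k * (qpoch p p k * qpoch p p m) = qpoch p p (m + k).
Proof.
move=> pg p0; elim: k m => [|k IHk] m.
  by rewrite qbin0 addn0 qpoch0 !mul1r.
have := qbin_step p (m + k.+1) k; rewrite addnS -addSn => H.
rewrite -(IHk m.+1) !qpochS.
have pk0 : p ^+ k != 0 by rewrite expf_neq0.
apply: (mulIf pk0).
move: H; rewrite !exprD !exprS => H.
by apply: (eq_of_multiple (k := qpoch p p k * qpoch p p m) H); ring.
Qed.


(** * The degenerate Watson transformation *)

(** Summation by parts for the Pascal rule, which drives inductions on the
    length of a terminating series. *)
Lemma qbin_pascal_sum p n (w : nat -> K) :
  \sum_(j < n.+2) qbin p n.+1 j * w j =
  \sum_(j < n.+1) qbin p n j * (p ^+ j * w j + w j.+1).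
Proof.
rewrite big_ord_recl qbin0.
under eq_bigr => j _ do rewrite lift0 qbinS mulrDl.
under [RHS]eq_bigr => j _ do rewrite mulrDr.
rewrite !big_split addrA; congr (_ + _).
rewrite big_ord_recr /= (@qbin_small p n n.+1) // mulr0 mul0r addr0.
rewrite [RHS]big_ord_recl qbin0 expr0 !mul1r; congr (_ + _).
by apply: eq_bigr => j _; rewrite lift0; ring.
Qed.

(** The 2phi1 sum with argument c q^n / a.  By the Pascal rule two
    consecutive terms combine into (1 - c / a) / (1 - c) times a term of the
    series of length n with c replaced by c p. *)
Lemma qVandermonde p a c n : a != 0 ->
  (forall i, (i < n)%N -> c * p ^+ i != 1) ->
  \sum_(j < n.+1) qbin p n j *
      ((-1) ^+ j * p ^+ 'C(j, 2) * (qpoch a p j / qpoch c p j) * (c / a) ^+ j)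
    = qpoch (c / a) p n / qpoch c p n.
Proof.
move=> a0; elim: n c => [|n IHn] c cP.
  by rewrite big_ord1 !qpoch0 bin_small // qbin0 !expr0 !invr1 !mulr1.
have c1 : 1 - c != 0.
  by rewrite subr_eq0 eq_sym -[c]mulr1 -(expr0 p) cP.
have cPi i : (i < n.+1)%N -> 1 - c * p ^+ i != 0.
  by move=> lin; rewrite subr_eq0 eq_sym cP.
pose w j := (-1) ^+ j * p ^+ 'C(j, 2) * (qpoch a p j / qpoch c p j)
  * (c / a) ^+ j.
rewrite (qbin_pascal_sum _ _ w) {}/w [in RHS]qpochSl [qpoch c p n.+1]qpochSl.
have cpP i : (i < n)%N -> c * p * p ^+ i != 1.
  by move=> lin; rewrite -mulrA -exprS cP.
transitivity ((1 - c / a) / (1 - c) *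
  (qpoch (c * p / a) p n / qpoch (c * p) p n)); last first.
  rewrite -[c / a * p]mulrAC.
  have cp0 := qpoch_neq0 cpP.
  by field; rewrite cp0 c1.
rewrite -IHn // mulr_sumr; apply: eq_bigr => j _.
have ljn := ltn_ord j.
have E : qpoch (c * p) p j = qpoch c p j * (1 - c * p ^+ j) / (1 - c).
  by rewrite -qpochS qpochSl; field.
have cj0 : qpoch c p j != 0.
  by apply: qpoch_neq0 => i lij; rewrite cP // (ltn_trans lij).
have cj1 := cPi j ljn.
rewrite E !qpochS expr_bin2S !exprMn !exprS.
by field; rewrite cj0 cj1 c1 a0.
Qed.

(** The terminating 6phi5 sum with one parameter sent to 0.  It is proved by
    a Wilf-Zeilberger pair: if f n t is the summand then
    (d - a p^(n+1)) f (n+1) t - (1 - a p^(n+1)) f n t = G (t+1) - G t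
    with an explicit G that vanishes at both ends of the range, and the
    closed form satisfies the same first-order recurrence in n. *)
Lemma vwp_sum_base p a d n : p != 0 -> d != 0 ->
  (forall i, (0 < i)%N -> p ^+ i != 1) ->
  (forall i, a * p ^+ i != 1) ->
  (forall i, (i < n)%N -> a * p / d * p ^+ i != 1) ->
  \sum_(t < n.+1) qbin p n t *
     ((1 - a * p ^+ (2 * t)) / (1 - a)
      * (qpoch a p t * qpoch d p t
         / (qpoch (a * p / d) p t * qpoch (a * p ^+ n.+1) p t)) / d ^+ t)
    = qpoch (a * p) p n / qpoch (a * p / d) p n / d ^+ n.
Proof.
move=> p0 d0 pP aP.
have aPi i : 1 - a * p ^+ i != 0 by rewrite subr_eq0 eq_sym.
have a1 : 1 - a != 0 by rewrite -[a]mulr1 -(expr0 p).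
elim: n => [|n IHn] adP.
  rewrite big_ord1 !qpoch0 qbin0 muln0 !expr0 !mulr1 (divff a1).
  by rewrite !invr1 !mulr1.
have adPi i : (i < n.+1)%N -> d - a * p * p ^+ i != 0.
  move=> lin; apply: contraNneq (adP i lin) => /subr0_eq E.
  by rewrite mulrAC -E divff.
have {}IHn := IHn (fun i lin => adP i (ltnW lin)).
set S := \sum_(_ < n.+1) _ in IHn; set S' := \sum_(_ < n.+2) _.
pose f m t := qbin p m t *
     ((1 - a * p ^+ (2 * t)) / (1 - a)
      * (qpoch a p t * qpoch d p t
         / (qpoch (a * p / d) p t * qpoch (a * p ^+ m.+1) p t)) / d ^+ t).
pose G t := if t is t'.+1 then
  - (1 - a * p ^+ n.+1) * qbin p n t' * (qpoch a p t * qpoch d p t)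
  / ((1 - a) * (qpoch (a * p / d) p t' * qpoch (a * p ^+ n.+1) p t * d ^+ t'))
  else 0.
have step t : (t < n.+2)%N ->
    (d - a * p ^+ n.+1) * f n.+1 t - (1 - a * p ^+ n.+1) * f n t = G t.+1 - G t.
  move=> ltn2; rewrite /f /G; case: t ltn2 => [|t] ltn2.
    rewrite !qbin0 !qpochS !qpoch0 muln0 !expr0 !mulr1.
    by have := aPi n.+1 => H; field; rewrite H a1 oner_eq0.
  have E : qpoch (a * p ^+ n.+2) p t.+1 = qpoch (a * p ^+ n.+1) p t
     * (1 - a * p ^+ n.+1 * p ^+ t) * (1 - a * p ^+ n.+1 * p ^+ t.+1)
     / (1 - a * p ^+ n.+1).
    rewrite -!qpochS [qpoch _ _ t.+2]qpochSl.
    rewrite -[in RHS](mulrA a) -exprSr.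
    by have := aPi n.+1 => H; field.
  have pt : 1 - p ^+ t.+1 != 0 by rewrite subr_eq0 eq_sym pP.
  have pt0 : p ^+ t != 0 by rewrite expf_neq0.
  have Eq : qbin p n t.+1 =
      qbin p n t * (p ^+ t - p ^+ n) / ((1 - p ^+ t.+1) * p ^+ t).
    by rewrite -qbin_step; field; rewrite pt pt0.
  rewrite qbinS E Eq !qpochS.
  have Q1 : qpoch (a * p / d) p t != 0.
    by apply: qpoch_neq0 => i lit; apply: adP; apply: ltn_trans lit _.
  have Q2 : qpoch (a * p ^+ n.+1) p t != 0.
    by apply: qpoch_neq0 => i _; rewrite -mulrA -exprD.
  have H1 := aPi n.+1.
  have H2 := aPi (n.+1 + t)%N; have H3 := aPi (n.+1 + t.+1)%N.
  have H4 := adPi t ltn2.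
  have dt : d ^+ t != 0 by rewrite expf_neq0.
  rewrite exprD mulrA in H2; rewrite exprD mulrA in H3.
  move: H1 H2 H3 H4 pt Q2.
  rewrite !mul2n -!addnn !exprD !exprS => H1 H2 H3 H4 pt Q2.
  by field; rewrite dt H2 Q2 Q1 a1 d0 H3 H4 pt0 pt H1.
have ES : (d - a * p ^+ n.+1) * S' - (1 - a * p ^+ n.+1) * S = 0.
  have -> : S = \sum_(t < n.+2) f n t.
    by rewrite big_ord_recr /= {2}/f qbin_small // mul0r addr0.
  rewrite !mulr_sumr -sumrB.
  rewrite (eq_bigr (fun t : 'I__ => G t.+1 - G t)); last first.
    by move=> t _; exact: (step t).
  rewrite -(big_mkord xpredT (fun t => G t.+1 - G t)) telescope_sumr //.
  by rewrite /G qbin_small // !(mulr0, mul0r) subrr.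
have H := adPi n (ltnSn n).
have Q1 : qpoch (a * p / d) p n != 0.
  by apply: qpoch_neq0 => i lit; apply: adP; apply: ltnW.
have dn : d ^+ n != 0 by rewrite expf_neq0.
move/subr0_eq: ES; rewrite IHn !qpochS !exprS => ES.
have H' : d - a * (p * p ^+ n) != 0 by rewrite mulrA.
apply: (mulfI H'); rewrite ES.
by field; rewrite H Q1 d0 dn.
Qed.

(** Reversal of the order of the factors, which brings the right-hand side of
    the q-Vandermonde sum to a factorial of b. *)
Lemma qpoch_reflect p b n : p != 0 -> b != 0 ->
  qpoch (p / (b * p ^+ n)) p n
  = (-1) ^+ n * qpoch b p n / (b ^+ n * p ^+ 'C(n, 2)).
Proof.
move=> p0 b0; elim: n => [|n IHn].
  by rewrite !qpoch0 bin_small // !expr0 !mul1r invr1.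
have pn0 : p ^+ n != 0 by rewrite expf_neq0.
rewrite qpochSl qpochS expr_bin2S !exprS.
have -> : p / (b * (p * p ^+ n)) * p = p / (b * p ^+ n).
  by field; rewrite pn0 b0.
rewrite IHn; field.
by rewrite b0 p0 pn0 !expf_neq0.
Qed.

Lemma sum_triangle (V : nmodType) (F : nat -> nat -> V) n :
  \sum_(s < n.+1) \sum_(j < s.+1) F s j
    = \sum_(j < n.+1) \sum_(t < (n - j).+1) F (j + t)%N j.
Proof.
elim: n => [|n IHn]; first by rewrite !big_ord1 addn0.
rewrite big_ord_recr IHn /= (big_ord_recr n.+1) [RHS]big_ord_recr /=.
rewrite subnn big_ord1 addn0 addrA; congr (_ + _).
rewrite -big_split; apply: eq_bigr => j _ /=.
have lej : (j <= n)%N by rewrite -ltnS.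
by rewrite subSn // [RHS]big_ord_recr /= addnS subnKC.
Qed.

Lemma qbin_mul p j m t : p != 0 -> (forall i, (0 < i)%N -> p ^+ i != 1) ->
  (t <= m)%N ->
  qbin p (j + m) (j + t) * qbin p (j + t) j = qbin p (j + m) j * qbin p m t.
Proof.
move=> p0 pP tm.
have pp k : qpoch p p k != 0.
  by apply: qpoch_neq0 => i _; rewrite -exprS pP.
have E n k : qbin p (n + k) k = qpoch p p (n + k) / (qpoch p p k * qpoch p p n).
  by rewrite -qbin_fact // mulfK // mulf_neq0.
rewrite -(subnK tm); move: (m - t)%N => r.
have -> : qbin p (j + (r + t)) (j + t) = qbin p (r + (j + t)) (j + t).
  by rewrite addnCA.
have -> : qbin p (j + (r + t)) j = qbin p (r + t + j) j by rewrite addnC.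
have -> : qbin p (j + t) j = qbin p (t + j) j by rewrite addnC.
rewrite !E addnAC -addnA (addnC j t).
by field; rewrite !pp.
Qed.

(** Watson's transformation of a terminating 8W7 into a balanced 4phi3, with
    two of the parameters of the 8W7 sent to 0 in such a way that the 4phi3
    becomes a 2phi1. *)
Theorem watson_degenerate p a b d n :
  p != 0 -> a != 0 -> b != 0 -> d != 0 ->
  (forall i, (0 < i)%N -> p ^+ i != 1) ->
  (forall i, a * p ^+ i != 1) ->
  (forall i, a * p / b * p ^+ i != 1) ->
  (forall i, (i < n)%N -> a * p / d * p ^+ i != 1) ->
  \sum_(s < n.+1)
     (1 - a * p ^+ (2 * s)) / (1 - a)
     * (qpoch a p s * qpoch b p s * qpoch d p s * qpoch (p ^- n) p s
        / (qpoch p p s * qpoch (a * p / b) p s * qpoch (a * p / d) p s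
           * qpoch (a * p ^+ n.+1) p s))
     * ((p ^+ n / (b * d)) ^+ s / (p ^+ 'C(s, 2)) ^+ 2)
  = qpoch (a * p) p n / qpoch (a * p / d) p n / d ^+ n
    * \sum_(j < n.+1) qpoch d p j * qpoch (p ^- n) p j
        / (qpoch p p j * qpoch (a * p / b) p j) * (p / b) ^+ j.
Proof.
move=> p0 a0 b0 d0 pP aP abP adP.
have pX k : p ^+ k != 0 by rewrite expf_neq0.
have aPi i : 1 - a * p ^+ i != 0 by rewrite subr_eq0 eq_sym.
have a1 : 1 - a != 0 by rewrite -[a]mulr1 -(expr0 p).
have pp k : qpoch p p k != 0.
  by apply: qpoch_neq0 => i _; rewrite -exprS pP.
have Qa k m : qpoch (a * p ^+ m) p k != 0.
  by apply: qpoch_neq0 => i _; rewrite -mulrA -exprD.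
have Qa0 k : qpoch a p k != 0 by exact: qpoch_neq0.
have Qb k : qpoch (a * p / b) p k != 0 by exact: qpoch_neq0.
have Qd k : (k <= n)%N -> qpoch (a * p / d) p k != 0.
  by move=> kn; apply: qpoch_neq0 => i ik; apply: adP; apply: leq_trans kn.
(* F s j is the term obtained when the quotient (b)_s / (a p / b)_s is expanded
   by q-Vandermonde with a p^s and a p / b as its two parameters. *)
pose F s j := qbin p n s * qbin p s j
   * ((1 - a * p ^+ (2 * s)) / (1 - a)
     * (qpoch a p s * qpoch d p s
        / (qpoch (a * p / d) p s * qpoch (a * p ^+ n.+1) p s)) / d ^+ s)
   * ((-1) ^+ j * p ^+ 'C(j, 2)
     * (qpoch (a * p ^+ s) p j / qpoch (a * p / b) p j)
     * (p / (b * p ^+ s)) ^+ j).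
transitivity (\sum_(s < n.+1) \sum_(j < s.+1) F s j).
  apply: eq_bigr => s _.
  have aps0 : a * p ^+ s != 0 by rewrite mulf_neq0.
  have := qVandermonde (n := s) aps0 (fun i _ => abP i).
  have -> : a * p / b / (a * p ^+ s) = p / (b * p ^+ s).
    by field; rewrite a0 b0 pX.
  rewrite qpoch_reflect // => V.
  pose X := qbin p n s * ((1 - a * p ^+ (2 * s)) / (1 - a)
     * (qpoch a p s * qpoch d p s
        / (qpoch (a * p / d) p s * qpoch (a * p ^+ n.+1) p s)) / d ^+ s).
  have sn : (s <= n)%N by rewrite -ltnS.
  transitivity (X * ((-1) ^+ s * qpoch b p s / (b ^+ s * p ^+ 'C(s, 2))
                     / qpoch (a * p / b) p s)).
    rewrite /X qpoch_negX // expr_div_n exprMn.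
    have := Qd _ sn => H; field.
    by rewrite !expf_neq0 // a1 Qa Qb H pp.
  rewrite -V mulr_sumr; apply: eq_bigr => j _.
  by rewrite /F /X; ring.
rewrite sum_triangle mulr_sumr; apply: eq_bigr => -[j lej] _ /=.
rewrite ltnS in lej.
have En : n = (j + (n - j))%N by rewrite subnKC.
move: (n - j)%N En => m En.
(* In the inner sum s = j + t, and the very-well-poised series in t has a and d
   replaced by a p^(2 j) and d p^j; Kj collects the factors without t. *)
pose Kj := qbin p n j * ((-1) ^+ j * p ^+ 'C(j, 2) * (p / b) ^+ j
    / qpoch (a * p / b) p j) * (qpoch a p (2 * j) * (1 - a * p ^+ (2 * j))
    / (1 - a) * qpoch d p j
    / (qpoch (a * p / d) p j * qpoch (a * p ^+ n.+1) p j) / d ^+ j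
    / (p ^+ j) ^+ j).
have aP2 i : a * p ^+ (2 * j) * p ^+ i != 1 by rewrite -mulrA -exprD.
have Ead : a * p ^+ (2 * j) * p / (d * p ^+ j) = a * p / d * p ^+ j.
  by rewrite mul2n -addnn exprD; field; rewrite d0 pX.
have adP2 i : (i < m)%N ->
    a * p ^+ (2 * j) * p / (d * p ^+ j) * p ^+ i != 1.
  by move=> im; rewrite Ead -mulrA -exprD adP // En ltn_add2l.
have dpj : d * p ^+ j != 0 by rewrite mulf_neq0.
have B := vwp_sum_base p0 dpj pP aP2 adP2.
rewrite Ead in B.
transitivity (Kj * (qpoch (a * p ^+ (2 * j) * p) p m
   / qpoch (a * p / d * p ^+ j) p m / (d * p ^+ j) ^+ m)).
  rewrite -B mulr_sumr; apply: eq_bigr => t _.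
  have tm : (t <= m)%N by rewrite -ltnS.
  have Q := qbin_mul j p0 pP tm.
  rewrite /F /Kj {1}En Q -En.
  have jtn : (j + t <= n)%N by rewrite En leq_add2l.
  have E1 : qpoch (a * p ^+ (j + t)) p j =
      qpoch a p (2 * j) * qpoch (a * p ^+ (2 * j)) p t / qpoch a p (j + t).
    rewrite -qpochD mul2n -addnn -addnA (addnC j t) addnA.
    by rewrite addnC qpochD addnC mulrAC divff // mul1r.
  have E2 : qpoch d p (j + t) = qpoch d p j * qpoch (d * p ^+ j) p t.
    by rewrite qpochD.
  have E3 : qpoch (a * p / d) p (j + t) = qpoch (a * p / d) p j
     * qpoch (a * p / d * p ^+ j) p t by rewrite qpochD.
  have E4 : qpoch (a * p ^+ n.+1) p (j + t) = qpoch (a * p ^+ n.+1) p j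
     * qpoch (a * p ^+ (2 * j) * p ^+ m.+1) p t.
    by rewrite qpochD -!mulrA -!exprD; congr (_ * qpoch (a * p ^+ _) _ _); lia.
  have H3 := Qd _ jtn; have H4 := Qa (j + t)%N n.+1.
  have H5 := Qa (2 * j)%N 0%N.
  have H6 := aPi (2 * j)%N.
  rewrite E1 E2.
  rewrite E3 mulf_eq0 negb_or in H3; rewrite E4 mulf_eq0 negb_or in H4.
  rewrite E3 E4.
  case/andP: H3 => H31 H32; case/andP: H4 => H41 H42.
  move: H6 H42.
  rewrite !mul2n -!addnn !exprD !expr_div_n !exprMn (exprAC p t j) => H6 H42.
  by field; rewrite H42 H32 H6 H41 H31 a1 Qb Qa0 !expf_neq0.
have E1 : qpoch a p (2 * j) * (1 - a * p ^+ (2 * j))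
    * qpoch (a * p ^+ (2 * j) * p) p m
    = (1 - a) * qpoch (a * p) p n * qpoch (a * p ^+ n.+1) p j.
  by rewrite -qpochSl -qpochS -mulrA -exprSr -!qpochD; congr qpoch; lia.
have E3 : qpoch (a * p / d) p n = qpoch (a * p / d) p j
     * qpoch (a * p / d * p ^+ j) p m by rewrite En qpochD.
have H3 := Qd n (leqnn n); rewrite E3 mulf_eq0 negb_or in H3.
case/andP: H3 => H31 H32.
have -> : qpoch (a * p ^+ (2 * j) * p) p m
    = (1 - a) * qpoch (a * p) p n * qpoch (a * p ^+ n.+1) p j
      / (qpoch a p (2 * j) * (1 - a * p ^+ (2 * j))).
  by rewrite -E1 [RHS]mulrC mulKf // mulf_neq0.
rewrite /Kj qpoch_negX // E3.
have -> : d ^+ n = d ^+ j * d ^+ m by rewrite En exprD.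
have -> : (p ^+ n) ^+ j = (p ^+ j) ^+ j * (p ^+ j) ^+ m.
  by rewrite En exprD exprMn (exprAC p m).
rewrite (exprMn m d).
have H1 := aPi (2 * j)%N.
have H4 := Qa j n.+1.
move: (p ^+ (2 * j)) (p ^+ n.+1) H1 H4 => x y H1 H4.
by field; rewrite H4 H1 H31 H32 a1 Qb Qa0 pp !expf_neq0.
Qed.
Lemma qbinn p n : qbin p n n = 1.
Proof.
by elim: n => [|n IHn] //; rewrite qbinS IHn qbin_small // mulr0 add0r.
Qed.

End QPochhammer.

(** * Explicit coefficients of the even-odd q-Lommel polynomials *)

Lemma half_cases D : D = (2 * D./2)%N /\ D.+1./2 = D./2
  \/ D = (2 * D./2).+1 /\ D.+1./2 = D./2.+1.
Proof. lia. Qed.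

Section LommelCoefficients.
Variable K : fieldType.
Variables c q : K.
Hypothesis c_neq0 : c != 0.
Hypothesis q_neq0 : q != 0.
Hypothesis q_generic : forall i : nat, (0 < i)%N -> q ^+ i != 1.
Hypothesis c_generic : forall i : nat, c * q ^+ i != 1.

(** The coefficient of X^D in p_(D + 2 m).  Only the argument of the series
    and one exponent depend on the parity of D, through D./2. *)
Definition lommel_coef (m D : nat) : K :=
  q ^+ (m * m + m * D./2) / (qpoch q q m * qpoch (c * q ^+ (m + D)) q m)
  * \sum_(j < m.+1) qpoch (c * q ^+ (m + D)) q j * qpoch (q ^- m) q j
      / (qpoch q q j * qpoch c q j) * (q ^- D./2) ^+ j.

Let cq_sub i : 1 - c * q ^+ i != 0.
Proof. by rewrite subr_eq0 eq_sym. Qed.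

Let q_sub i : 1 - q ^+ i.+1 != 0.
Proof. by rewrite subr_eq0 eq_sym q_generic. Qed.

Let qX i : q ^+ i != 0.
Proof. by rewrite expf_neq0. Qed.

Let qpoch_q i : qpoch q q i != 0.
Proof. by apply: qpoch_neq0 => k _; rewrite -exprS q_generic. Qed.

Let qpoch_c i n : qpoch (c * q ^+ n) q i != 0.
Proof. by apply: qpoch_neq0 => k _; rewrite -mulrA -exprD. Qed.

Let qpoch_c0 i : qpoch c q i != 0.
Proof. by rewrite -[c]mulr1 -(expr0 q) qpoch_c. Qed.

Lemma lommel_coef0 D : lommel_coef 0 D = 1.
Proof.
by rewrite /lommel_coef big_ord1 !qpoch0 muln0 mul0n !expr0 !mulr1 invr1 !mulr1.
Qed.

Let qpoch_negS m j :
  qpoch (q ^- m) q j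
  = qpoch (q ^- m.+1) q j * (1 - q ^- m.+1 * q ^+ j) / (1 - q ^- m.+1).
Proof.
have qm : 1 - q ^- m.+1 != 0.
  rewrite subr_eq0 eq_sym; apply: contraNneq (q_generic (ltn0Sn m)).
  by move=> /(congr1 GRing.inv); rewrite invrK invr1 => ->.
have E : q ^- m.+1 * q = q ^- m by rewrite exprS; field; rewrite qX q_neq0.
by rewrite -qpochS qpochSl E [RHS]mulrC mulKf.
Qed.

Let qpoch_shift b j : 1 - b != 0 ->
  qpoch (b * q) q j = qpoch b q j * (1 - b * q ^+ j) / (1 - b).
Proof. by move=> b1; rewrite -qpochS qpochSl [RHS]mulrC mulKf. Qed.

Lemma lommel_lambda_even n : lommel_lambda c q (2 * n.+1) =
  c * q ^+ (3 * n + 2)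
  / ((1 - c * q ^+ (2 * n).+1) * (1 - c * q ^+ (2 * n).+2)).
Proof.
have E1 : odd (2 * n.+1) = false by lia.
have E2 : (2 * n.+1)./2 = n.+1 by lia.
rewrite /lommel_lambda E1 E2.
have -> : ((3 * n.+1)%:Z - 1 = (3 * n + 2)%N :> int) by lia.
have -> : ((2 * n.+1)%:Z - 1 = (2 * n).+1 :> int) by lia.
by have -> : (2 * n.+1 = (2 * n).+2)%N by lia.
Qed.

Lemma lommel_lambda_odd n : lommel_lambda c q (2 * n).+1 =
  q ^+ n / ((1 - c * q ^+ (2 * n)) * (1 - c * q ^+ (2 * n).+1)).
Proof.
have E1 : odd (2 * n).+1 by lia.
have E2 : (2 * n).+1./2 = n by lia.
by rewrite /lommel_lambda E1 E2.
Qed.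

(** The recurrence at the coefficient of X^(D+1).  The three series involved
    are a 2phi1 with parameters b and q^-(m+1), the one with b replaced by
    b q, and the one with q^-(m+1) replaced by q^-m; so their j-th terms
    differ by factors that are rational in q^j, and the relation holds for
    each j separately. *)
Lemma lommel_coefSS m D :
  lommel_coef m.+1 D.+1 =
  lommel_coef m.+1 D - lommel_lambda c q (D + (2 * m).+2) * lommel_coef m D.+1.
Proof.
pose b := c * q ^+ (m.+1 + D).
rewrite /lommel_coef.
have -> : c * q ^+ (m.+1 + D.+1) = b * q by rewrite /b addnS exprSr mulrA.
have -> : c * q ^+ (m + D.+1) = b by rewrite /b addnS addSn.
rewrite -/b.
(* The shorter series is padded with a vanishing term, in order to compare the
   three sums index by index. *)
set s3 := \sum_(j < m.+1) _.
have -> : s3 = \sum_(j < m.+2) qpoch b q j * qpoch (q ^- m) q j /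
      (qpoch q q j * qpoch c q j) * (q ^- D.+1./2) ^+ j.
  rewrite [RHS]big_ord_recr /= qpoch_negX // qbin_small //.
  by rewrite !(mul0r, mulr0) addr0.
rewrite {}/s3 !mulr_sumr -sumrB; apply: eq_bigr => j _.
have b1 : 1 - b != 0 by exact: cq_sub.
have bm : 1 - b * q ^+ m != 0 by rewrite /b -mulrA -exprD cq_sub.
have bm1 : 1 - b * q ^+ m.+1 != 0 by rewrite /b -mulrA -exprD cq_sub.
have Qb : qpoch b q m != 0 by exact: qpoch_c.
rewrite !(qpoch_shift _ b1) (qpoch_negS m) !qpochS.
have qm1 := q_sub m.
have Eq m' k : q ^+ (m'.+1 * m'.+1 + m'.+1 * k)
    = q ^+ (m' * m' + m' * k) * q ^+ m' ^+ 2 * q * q ^+ k.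
  by rewrite -!exprM -!exprD -exprSr -!exprD; congr (_ ^+ _); lia.
rewrite !Eq.
rewrite !exprVn.
have cj := qpoch_c0 j; have qqj := qpoch_q j; have qqm := qpoch_q m.
have qnm1 : 1 - q ^- m.+1 != 0.
  rewrite subr_eq0 eq_sym; apply: contraNneq (q_generic (ltn0Sn m)).
  by move=> /(congr1 GRing.inv); rewrite invrK invr1 => ->.
set h := D./2; set h' := D.+1./2.
set lam := lommel_lambda c q _.
(* Every factorial is common to the three terms; key is what remains. *)
suff key : q ^+ (m * m + m * h') * q ^+ m ^+ 2 * q * q ^+ h' / q ^+ h' ^+ j
    * ((1 - b * q ^+ j)
       / ((1 - q ^+ m.+1) * (1 - b * q ^+ m) * (1 - b * q ^+ m.+1)))
  = q ^+ (m * m + m * h) * q ^+ m ^+ 2 * q * q ^+ h / q ^+ h ^+ j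
    / ((1 - q ^+ m.+1) * (1 - b * q ^+ m))
  - lam * (q ^+ (m * m + m * h') / q ^+ h' ^+ j
     * ((1 - q ^- m.+1 * q ^+ j) / (1 - q ^- m.+1))).
  rewrite -exprS.
  move: key bm bm1 b1 qm1 Qb qqm cj qqj qnm1.
  move: (q ^+ h') (q ^+ h) (q ^+ m) (q ^+ (m * m + m * h))
    (q ^+ (m * m + m * h')) (qpoch (q ^- m.+1) q j) (qpoch c q j)
    (qpoch q q j) (qpoch q q m) (qpoch b q j) (qpoch b q m)
    (q ^+ h ^+ j)^-1 (q ^+ h' ^+ j)^-1
    (1 - q ^- m.+1) (1 - q ^- m.+1 * q ^+ j) (1 - b) (1 - q ^+ m.+1)
    (1 - b * q ^+ m.+1) (1 - b * q ^+ m) (1 - b * q ^+ j).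
  move=> y' y x P P' Aj Cj Qj Qm Bj Bm Z Z' s7 s6 s4 s1 s3 s2 s5.
  move=> key s2n s3n s4n s1n Bmn Qmn Cjn Qjn s7n.
  transitivity (Bj * Aj / (Qm * Bm * Qj * Cj) *
     (P' * x ^+ 2 * q * y' * Z' * (s5 / (s1 * s2 * s3)))).
    by field; rewrite s2n s3n s4n s1n Bmn Qmn Cjn Qjn.
  rewrite key mulrBr; congr (_ - _).
    by field; rewrite s2n s1n Bmn Qmn Cjn Qjn.
  by field; rewrite s7n Bmn Qmn Cjn Qjn.
have qm := qX m; have qk := qX h; have qj := qX j.
have qkj : q ^+ h ^+ j != 0 by rewrite expf_neq0.
have [[De Eh]|[De Eh]] := half_cases D; rewrite -/h -/h' in De Eh; rewrite Eh.
- have -> : lam = b * q ^+ m ^+ 2 * q ^+ h * q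
      / ((1 - b * q ^+ m) * (1 - b * q ^+ m.+1)).
    have E : (D + (2 * m).+2 = 2 * (m + h).+1)%N by rewrite {1}De; clear; lia.
    have -> : b * q ^+ m ^+ 2 * q ^+ h * q = c * q ^+ (3 * (m + h) + 2).
      rewrite /b -exprM -!mulrA -exprSr -!exprD De.
      by congr (_ * _ ^+ _); clear; lia.
    have -> : b * q ^+ m = c * q ^+ (2 * (m + h)).+1.
      by rewrite /b De -mulrA -exprD; congr (_ * _ ^+ _); clear; lia.
    have -> : b * q ^+ m.+1 = c * q ^+ (2 * (m + h)).+2.
      by rewrite /b De -mulrA -exprD; congr (_ * _ ^+ _); clear; lia.
    by rewrite /lam E lommel_lambda_even.
  move: bm1 qm1 qnm1; rewrite !exprS => bm1 qm1 qnm1.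
  have qm1' : q * q ^+ m - 1 != 0 by rewrite -opprB oppr_eq0.
  by field; rewrite qm q_neq0 qm1' qkj bm1 bm qm1.
have -> : lam = q ^+ m * q ^+ h * q
    / ((1 - b * q ^+ m) * (1 - b * q ^+ m.+1)).
  have E : (D + (2 * m).+2 = (2 * (m + h).+1).+1)%N.
    by rewrite {1}De; clear; lia.
  have -> : q ^+ m * q ^+ h * q = q ^+ (m + h).+1 by rewrite exprSr exprD.
  have -> : b * q ^+ m = c * q ^+ (2 * (m + h).+1).
    by rewrite /b De -mulrA -exprD; congr (_ * _ ^+ _); clear; lia.
  have -> : b * q ^+ m.+1 = c * q ^+ (2 * (m + h).+1).+1.
    by rewrite /b De -mulrA -exprD; congr (_ * _ ^+ _); clear; lia.
  by rewrite /lam E lommel_lambda_odd.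
rewrite mulnS addnCA exprD.
move: bm1 qm1 qnm1; rewrite !exprS exprMn => bm1 qm1 qnm1.
have qm1' : q * q ^+ m - 1 != 0 by rewrite -opprB oppr_eq0.
by field; rewrite qm q_neq0 qm1' qkj qj bm1 bm qm1.
Qed.

(** For D = 0 the argument of the series is 1, which is exactly the argument
    required by q-Vandermonde when the upper parameter is c q^m and the lower
    one is c. *)
Lemma lommel_coef_const m :
  lommel_coef m 0 = (-1) ^+ m * q ^+ 'C(m, 2) / qpoch c q (2 * m).
Proof.
have a0 : c * q ^+ m != 0 by rewrite mulf_neq0.
have := qVandermonde (n := m) a0 (fun i _ => c_generic i).
have -> : c / (c * q ^+ m) = q ^- m by field; rewrite qX c_neq0.
rewrite qpoch_negX // qbinn => V.
have Q1 := qpoch_c m m; have Q2 := qpoch_c0 m; have Q3 := qpoch_q m.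
rewrite /lommel_coef addn0.
rewrite (eq_bigr (fun j : 'I_m.+1 => qbin q m j * ((-1) ^+ j * q ^+ 'C(j, 2)
    * (qpoch (c * q ^+ m) q j / qpoch c q j) * (q ^- m) ^+ j))); last first.
  move=> j _; rewrite qpoch_negX //= invr1 expr1n exprVn.
  by field; rewrite qpoch_c0 qpoch_q expf_neq0.
rewrite V mul2n -addnn qpochD muln0 addn0 exprM.
by field; rewrite Q1 Q2 Q3 expf_neq0.
Qed.

(** The recurrence at the constant term, where the factor X leaves only one of
    the two summands. *)
Lemma lommel_coefS_const m :
  lommel_coef m.+1 0 = - lommel_lambda c q (2 * m).+1 * lommel_coef m 0.
Proof.
rewrite !lommel_coef_const lommel_lambda_odd expr_bin2S mulnS !qpochS exprS.
have H1 := cq_sub (2 * m); have H2 := cq_sub (2 * m).+1.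
by field; rewrite H1 H2 qpoch_c0.
Qed.

Definition lommel_even n : {poly K} :=
  \sum_(k < n.+1) lommel_coef (n - k) (2 * k) *: 'X^(2 * k).

(** The odd polynomials are stored without their factor X. *)
Definition lommel_odd n : {poly K} :=
  \sum_(k < n.+1) lommel_coef (n - k) (2 * k).+1 *: 'X^(2 * k).

Lemma lommel_evenS n :
  lommel_even n.+1 =
  'X^2 * lommel_odd n - lommel_lambda c q (2 * n).+1 *: lommel_even n.
Proof.
have split0 m : lommel_even m = (lommel_coef m 0)%:P
    + \sum_(k < m) lommel_coef (m - k.+1) (2 * k).+2 *: 'X^((2 * k).+2).
  rewrite /lommel_even big_ord_recl subn0 muln0 expr0 alg_polyC.
  by congr (_ + _); apply: eq_bigr => k _; rewrite lift0 mulnS.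
rewrite !split0 /lommel_odd lommel_coefS_const.
rewrite big_ord_recr /= [in RHS]big_ord_recr /= !subnn !lommel_coef0 !scale1r.
rewrite mulrDr -exprD add2n scalerDr.
rewrite [X in _ + (X + _) = _](_ : _ =
  'X^2 * (\sum_(k < n) lommel_coef (n - k) (2 * k).+1 *: 'X^(2 * k))
  - lommel_lambda c q (2 * n).+1 *: (\sum_(k < n)
      lommel_coef (n - k.+1) (2 * k).+2 *: 'X^((2 * k).+2))).
  by rewrite -[_ *: _%:P]mul_polyC -rmorphM mulNr rmorphN /=; ring.
rewrite mulr_sumr scaler_sumr -sumrB; apply: eq_bigr => -[k kn] _ /=.
rewrite -scalerAr -exprD add2n scalerA -scalerBl; congr (_ *: _).
have -> : (n.+1 - k.+1 = (n - k.+1).+1)%N by clear -kn; lia.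
have -> : (n - k = (n - k.+1).+1)%N by clear -kn; lia.
rewrite lommel_coefSS; congr (_ - lommel_lambda c q _ * _).
by clear -kn; lia.
Qed.

Lemma lommel_oddS n :
  lommel_odd n.+1 =
  lommel_even n.+1 - lommel_lambda c q (2 * n.+1) *: lommel_odd n.
Proof.
rewrite /lommel_even /lommel_odd !(big_ord_recr n.+1) subnn !lommel_coef0 /=.
rewrite scaler_sumr addrAC; congr (_ + _); rewrite -sumrB.
apply: eq_bigr => -[k kn] _ /=; rewrite ltnS in kn.
rewrite subSn // scalerA -scalerBl; congr (_ *: _).
rewrite lommel_coefSS; congr (_ - lommel_lambda c q _ * _).
by clear -kn; lia.
Qed.

Lemma qLommel_explicit n : qLommel c q (2 * n) = lommel_even n
  /\ qLommel c q (2 * n).+1 = 'X * lommel_odd n.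
Proof.
elim: n => [|n [IHe IHo]].
  rewrite qLommel0 qLommel1 /lommel_even /lommel_odd !big_ord1 !lommel_coef0.
  by rewrite muln0 expr0 scale1r mulr1.
have He : qLommel c q (2 * n.+1) = lommel_even n.+1.
  rewrite mulnS qLommelSS IHe IHo lommel_evenS exprS expr1.
  by rewrite mulrA.
split=> //; have -> : (2 * n.+1).+1 = (2 * n).+3 by rewrite mulnS.
rewrite qLommelSS -[(2 * n).+2](mulnS 2 n) He IHo lommel_oddS mulnS.
by rewrite mulrBr scalerAr.
Qed.

End LommelCoefficients.
(** * Coefficientwise limits *)

Section CoefficientwiseLimits.
Variable K : numFieldType.
Variable F : set_system K.
Context {FF : Filter F}.
Implicit Types (f g : K -> K) (r s : K -> {poly K}).

Lemma cvg_near f g (l : K) : (\forall a \near F, f a = g a) ->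
  g a @[a --> F] --> l -> f a @[a --> F] --> l.
Proof.
move=> fg; apply: cvg_trans; apply: near_eq_cvg.
by near do apply/esym.
Unshelve. all: by end_near. Qed.

Lemma cvg_limE f (l l' : K) : l' = l ->
  f a @[a --> F] --> l' -> f a @[a --> F] --> l.
Proof. by move=> ->. Qed.

Lemma cvg_sum_ord n (f : 'I_n -> K -> K) (l : 'I_n -> K) :
  (forall i, f i a @[a --> F] --> l i) ->
  (\sum_(i < n) f i a) @[a --> F] --> \sum_(i < n) l i.
Proof.
move=> fl; apply: cvg_big => // x; exact: add_continuous.
Qed.

Lemma cvg_exprn f (l : K) n :
  f a @[a --> F] --> l -> (f a ^+ n) @[a --> F] --> l ^+ n.
Proof.
move=> fl; elim: n => [|n IHn]; first exact: cvg_cst.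
under eq_fun do rewrite exprS; rewrite exprS.
exact: cvgM.
Qed.

Lemma coef_cvg_near r s L : (\forall a \near F, r a = s a) ->
  coef_cvg F s L -> coef_cvg F r L.
Proof.
move=> rs sL i; apply: cvg_near (sL i).
by apply: filterS rs => a ->.
Qed.

Lemma coef_cvg_cst L : coef_cvg F (fun=> L) L.
Proof. by move=> i; exact: cvg_cst. Qed.

Lemma coef_cvgC f (l : K) : f a @[a --> F] --> l ->
  coef_cvg F (fun a => (f a)%:P) l%:P.
Proof.
move=> fl i; rewrite coefC; under eq_fun do rewrite coefC.
by case: (i == 0%N) => //; exact: cvg_cst.
Qed.

Lemma coef_cvgZ f r (l : K) L : f a @[a --> F] --> l -> coef_cvg F r L ->
  coef_cvg F (fun a => f a *: r a) (l *: L).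
Proof.
move=> fl rL i; rewrite coefZ; under eq_fun do rewrite coefZ.
exact: cvgM.
Qed.

Lemma coef_cvgB r s L M : coef_cvg F r L -> coef_cvg F s M ->
  coef_cvg F (fun a => r a - s a) (L - M).
Proof.
move=> rL sM i; rewrite coefB; under eq_fun do rewrite coefB.
by apply: cvgB; [exact: rL|exact: sM].
Qed.

Lemma coef_cvgM r s L M : coef_cvg F r L -> coef_cvg F s M ->
  coef_cvg F (fun a => r a * s a) (L * M).
Proof.
move=> rL sM i; rewrite coefM; under eq_fun do rewrite coefM.
by apply: cvg_sum_ord => j; apply: cvgM; [exact: rL|exact: sM].
Qed.

Lemma coef_cvg_sum n (r : 'I_n -> K -> {poly K}) (L : 'I_n -> {poly K}) :
  (forall k, coef_cvg F (r k) (L k)) ->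
  coef_cvg F (fun a => \sum_(k < n) r k a) (\sum_(k < n) L k).
Proof.
move=> rL i; rewrite coef_sum; under eq_fun do rewrite coef_sum.
by apply: cvg_sum_ord => k; exact: rL.
Qed.

Lemma coef_cvg_prod n (r : nat -> K -> {poly K}) (L : nat -> {poly K}) :
  (forall k, coef_cvg F (r k) (L k)) ->
  coef_cvg F (fun a => \prod_(k < n) r k a) (\prod_(k < n) L k).
Proof.
move=> rL; elim: n => [|n IHn].
  by rewrite big_ord0; under eq_fun do rewrite big_ord0; exact: coef_cvg_cst.
rewrite big_ord_recr; under eq_fun do rewrite big_ord_recr.
exact: coef_cvgM.
Qed.

End CoefficientwiseLimits.

(** * Factorials with a large parameter *)

Section LargeParameter.
Variable K : numFieldType.
Implicit Types x p a l : K.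
Local Notation oo := (@norm_infty K).

Lemma near_norm_infty_neq0 : \forall a \near oo, a != 0.
Proof.
rewrite nearE /norm_infty /=; near=> M => a.
have M0 : 0 < M by near: M; exact: nbhs_pinfty_gt.
by apply: contraTneq => ->; rewrite normr0 lt_gtF.
Unshelve. all: by end_near. Qed.

Lemma cvg_inv_norm_infty : a^-1 @[a --> oo] --> (0 : K).
Proof.
apply/cvgr0Pnorm_lt => e e0.
rewrite nearE /norm_infty /=; near=> M => a.
have M0 : e^-1 < M by near: M; apply: nbhs_pinfty_gt; rewrite realV gtr0_real.
move=> Ma; rewrite normfV -[e]invrK ltf_pV2 ?posrE ?invr_gt0 //.
  exact: lt_trans Ma.
by rewrite (lt_trans _ Ma) // (lt_trans _ M0) // invr_gt0.
Unshelve. all: by end_near. Qed.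

Lemma cvg_qpoch_small x p k : qpoch (x / a) p k @[a --> oo] --> (1 : K).
Proof.
elim: k => [|k IHk].
  by under eq_fun do rewrite qpoch0; exact: cvg_cst.
under eq_fun do rewrite qpochS.
apply: (@cvg_limE _ _ _ _ (1 * (1 - x * 0 * p ^+ k))); first by ring.
apply: cvgM => //; apply: cvgB; first exact: cvg_cst.
apply: cvgM; last exact: cvg_cst.
by apply: cvgM; [exact: cvg_cst|exact: cvg_inv_norm_infty].
Qed.

(** Each factor 1 - x a p^i, divided by a, tends to - x p^i. *)
Lemma cvg_qpoch_large x p k :
  qpoch (x * a) p k / a ^+ k @[a --> oo] --> (- x) ^+ k * p ^+ 'C(k, 2).
Proof.
elim: k => [|k IHk].
  under eq_fun do rewrite qpoch0 expr0 invr1 mulr1.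
  by rewrite bin_small // !expr0 mulr1; exact: cvg_cst.
have -> : (- x) ^+ k.+1 * p ^+ 'C(k.+1, 2)
    = (- x) ^+ k * p ^+ 'C(k, 2) * (0 - x * p ^+ k).
  by rewrite expr_bin2S exprS; ring.
apply: (@cvg_near _ _ _ _
   (fun a => qpoch (x * a) p k / a ^+ k * (a^-1 - x * p ^+ k))).
  near=> a; have a0 : a != 0 by near: a; exact: near_norm_infty_neq0.
  by rewrite qpochS exprS; field; rewrite a0 expf_neq0.
apply: cvgM => //; apply: cvgB; last exact: cvg_cst.
exact: cvg_inv_norm_infty.
Unshelve. all: by end_near. Qed.

End LargeParameter.
(** * The limit of the very-well-poised series *)

(** The two kinds are treated together in base p.  The constant beta =
    A / alpha is written kap p^2, so that only natural powers of p occur; the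
    first kind uses kap = c, and the second one, in base 1/q, uses
    kap = q / c. *)

Section AssociatedAskeyWilsonLimit.
Variables (K : numFieldType) (eps : aw_kind) (kap p : K).
Hypothesis kap_neq0 : kap != 0.
Hypothesis p_neq0 : p != 0.
Hypothesis p_generic : forall i : nat, (0 < i)%N -> p ^+ i != 1.
Hypothesis kap_generic : forall i : nat, kap * p ^+ i != 1.
Local Notation oo := (@norm_infty K).

(** With this shift e, the pair (S, T) is (p^(k+1) / p^e, p^e A^2) for both
    kinds. *)
Definition kind_shift := match eps with Eps1 => 0%N | Eps2 => 1%N end.
Local Notation e := kind_shift.

Lemma aw_WE (A B C D alpha : K) n k :
  aw_W eps A B C D alpha p n k =
  vwp_sum (n - k) (A * B * C * D * alpha ^+ 2 * p ^ (k%:Z - 2))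
    [:: alpha; B * C * alpha / p; B * D * alpha / p; C * D * alpha / p;
        p ^+ k.+1 / p ^+ e;
        A * B * C * D * alpha ^+ 2 * p ^ ((n + k)%:Z - 1);
        p ^ (k%:Z - n%:Z)]
    p (p ^+ e * A ^+ 2).
Proof.
rewrite /aw_W /e; case: eps.
  by rewrite expr0 invr1 mulr1 mul1r.
by rewrite !expr1 [p ^+ k.+1]exprSr mulfK.
Qed.

Let exprzB (m n : nat) : p ^ (m%:Z - n%:Z) = p ^+ m / p ^+ n.
Proof. by rewrite expfzDr // -exprnN. Qed.

Let pX i : p ^+ i != 0.
Proof. by rewrite expf_neq0. Qed.

Let kap_sub i : 1 - kap * p ^+ i != 0.
Proof. by rewrite subr_eq0 eq_sym. Qed.

Let qpoch_p i : qpoch p p i != 0.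
Proof. by apply: qpoch_neq0 => k _; rewrite -exprS p_generic. Qed.

Let qpoch_kap i n : qpoch (kap * p ^+ n) p i != 0.
Proof. by apply: qpoch_neq0 => k _; rewrite -mulrA -exprD. Qed.

(** The part of the s-th term of W_k that does not depend on alpha, apart from
    the power of T. *)
Definition vwp_factor n k s : K :=
  let a := kap * p ^+ k in
  let b := p ^+ k.+1 / p ^+ e in
  let d := kap * p ^+ (n + k).+1 in
  (1 - a * p ^+ (2 * s)) / (1 - a)
     * (qpoch a p s * qpoch b p s * qpoch d p s * qpoch (p ^- (n - k)) p s
        / (qpoch p p s * qpoch (a * p / b) p s * qpoch (a * p / d) p s
           * qpoch (a * p ^+ (n - k).+1) p s)).

Let neg_generic n i : (i < n)%N -> p ^- n * p ^+ i != 1.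
Proof.
move=> lin; rewrite -(subnK (ltnW lin)) exprD invfM mulfVK //.
by rewrite -[1]invr1 (inj_eq invr_inj) p_generic // subn_gt0.
Qed.

Let ratio_b k : kap * p ^+ k * p / (p ^+ k.+1 / p ^+ e) = kap * p ^+ e.
Proof. by rewrite exprS; field; rewrite p_neq0 !pX. Qed.

Let ratio_d n k : kap * p ^+ k * p / (kap * p ^+ (n + k).+1) = p ^- n.
Proof. by rewrite exprS exprD; field; rewrite p_neq0 kap_neq0 !pX. Qed.

(** For nonzero alpha, the term is a constant times normalised factorials,
    because T^s is of order alpha^(2 s) and the three large denominator
    factors and the large numerator factor contribute alpha^(-2 s). *)
Lemma aw_W_large n k a : (k <= n)%N -> a != 0 ->
  aw_W eps (kap * p ^+ 2 * a) a^-1 a^-1 a^-1 a p n k =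
  \sum_(s < (n - k).+1) vwp_factor n k s * (p ^+ e * (kap * p ^+ 2) ^+ 2) ^+ s
    * (qpoch (1 * a) p s / a ^+ s * qpoch (p^-1 / a) p s ^+ 3
       / (qpoch (kap * p ^+ k.+1 / a) p s
          * (qpoch (kap * p ^+ k.+2 * a) p s / a ^+ s) ^+ 3)).
Proof.
move=> kn a0; rewrite aw_WE /vwp_sum; apply: eq_bigr => s _.
rewrite (exprzB k 2) (exprzB _ 1) (exprzB k n) expr1.
have -> : kap * p ^+ 2 * a / a / a / a * a ^+ 2 * (p ^+ k / p ^+ 2)
    = kap * p ^+ k.
  by field; rewrite p_neq0 a0.
have -> : kap * p ^+ 2 * a / a / a / a * a ^+ 2 * (p ^+ (n + k) / p)
    = kap * p ^+ (n + k).+1.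
  by rewrite [p ^+ (n + k).+1]exprS; field; rewrite p_neq0 a0.
have -> : a^-1 / a * a / p = p^-1 / a by field; rewrite p_neq0 a0.
have -> : p ^+ k / p ^+ n = p ^- (n - k).
  by rewrite -{1}(subnK kn) exprD invfM mulrCA mulfV // mulr1.
rewrite /vwp_factor.
set u := kap * p ^+ k; set b := p ^+ k.+1 / p ^+ e.
set d := kap * p ^+ (n + k).+1.
have E1 : u * p / (p^-1 / a) = kap * p ^+ k.+2 * a.
  by rewrite /u !exprS; field; rewrite p_neq0 a0.
have E2 : u * p / a = kap * p ^+ k.+1 / a by rewrite /u exprSr !mulrA.
have E3 : u * p / p ^- (n - k) = u * p ^+ (n - k).+1.
  by rewrite invrK exprS mulrA.
rewrite /qpochs /= !big_cons !big_nil E1 E2 E3 !mulr1 mul1r.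
move: (qpoch (kap * p ^+ k.+2 * a) p s) => X1.
move: (qpoch (kap * p ^+ k.+1 / a) p s) => X2.
move: (qpoch (p^-1 / a) p s) (qpoch a p s) => X3 X4.
(* X1 and X2 may vanish for exceptional values of a; both sides are then 0. *)
have [->|X1n] := eqVneq X1 0; first by rewrite !(mul0r, mulr0, expr0n, invr0).
have [->|X2n] := eqVneq X2 0; first by rewrite !(mul0r, mulr0, invr0).
have H1 : qpoch (u * p ^+ (n - k).+1) p s != 0.
  by rewrite /u -mulrA -exprD qpoch_kap.
have H2 : qpoch (u * p / d) p s != 0.
  rewrite ratio_d; apply: qpoch_neq0 => i lis; apply: neg_generic.
  by rewrite (leq_trans lis) // (leq_trans _ (leq_subr k n)) // -ltnS.
have H3 : qpoch (u * p / b) p s != 0 by rewrite ratio_b qpoch_kap.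
have H4 : 1 - u != 0 by exact: kap_sub.
rewrite !exprMn; field.
by rewrite expf_neq0 // X1n X2n H1 H2 H3 H4 qpoch_p.
Qed.

(** The limiting series is the left-hand side of [watson_degenerate] with
    a = kap p^k, b = S and d = kap p^(n+k+1): the leading coefficients of the
    large factorials combine into its argument p^(n-k) / (b d). *)
Lemma vwp_factor_sum n k : (k <= n)%N ->
  \sum_(s < (n - k).+1) vwp_factor n k s
     * (p ^+ e * (kap * p ^+ 2) ^+ 2) ^+ s
     * ((- 1) ^+ s * p ^+ 'C(s, 2)
        / ((- (kap * p ^+ k.+2)) ^+ s * p ^+ 'C(s, 2)) ^+ 3)
  = qpoch (kap * p ^+ k.+1) p (n - k) / qpoch (p ^- n) p (n - k)
      / (kap * p ^+ (n + k).+1) ^+ (n - k)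
    * \sum_(j < (n - k).+1)
        qpoch (kap * p ^+ (n + k).+1) p j * qpoch (p ^- (n - k)) p j
        / (qpoch p p j * qpoch (kap * p ^+ e) p j) * (p ^+ e / p ^+ k) ^+ j.
Proof.
move=> kn.
have b0 : p ^+ k.+1 / p ^+ e != 0 by rewrite mulf_neq0 ?invr_eq0.
have W := @watson_degenerate _ p (kap * p ^+ k) (p ^+ k.+1 / p ^+ e)
  (kap * p ^+ (n + k).+1) (n - k) p_neq0.
rewrite ratio_b ratio_d in W.
have -> : p ^+ e / p ^+ k = p / (p ^+ k.+1 / p ^+ e).
  by rewrite exprS; field; rewrite p_neq0 !pX.
have -> : kap * p ^+ k.+1 = kap * p ^+ k * p by rewrite exprSr mulrA.
rewrite -W //; last 5 first.
- by rewrite mulf_neq0.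
- by rewrite mulf_neq0.
- by move=> i; rewrite -mulrA -exprD.
- by move=> i; rewrite -mulrA -exprD.
- move=> i lin; apply: neg_generic.
  by rewrite (leq_trans lin) // leq_subr.
apply: eq_bigr => s _.
rewrite /vwp_factor ratio_b ratio_d -[LHS]mulrA; congr (_ * _).
have -> : p ^+ (n - k) / (p ^+ k.+1 / p ^+ e * (kap * p ^+ (n + k).+1))
    = -1 * (p ^+ e * (kap * p ^+ 2) ^+ 2) / (- (kap * p ^+ k.+2)) ^+ 3.
  rewrite -{2}(subnK kn) !exprS !exprD; field.
  by rewrite !pX kap_neq0 p_neq0.
have Y0 : - (kap * p ^+ k.+2) != 0 by rewrite oppr_eq0 mulf_neq0.
move: (- (kap * _)) Y0 (p ^+ e * _) => Y Y0 X.
rewrite expr_div_n (exprAC _ 3) !exprMn.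
by field; rewrite pX expf_neq0.
Qed.

Lemma cvg_aw_W n k : (k <= n)%N ->
  aw_W eps (kap * p ^+ 2 * a) a^-1 a^-1 a^-1 a p n k @[a --> oo] -->
  qpoch (kap * p ^+ k.+1) p (n - k) / qpoch (p ^- n) p (n - k)
      / (kap * p ^+ (n + k).+1) ^+ (n - k)
    * \sum_(j < (n - k).+1)
        qpoch (kap * p ^+ (n + k).+1) p j * qpoch (p ^- (n - k)) p j
        / (qpoch p p j * qpoch (kap * p ^+ e) p j) * (p ^+ e / p ^+ k) ^+ j.
Proof.
move=> kn; rewrite -vwp_factor_sum //.
apply: cvg_near.
  near=> a; have a0 : a != 0 by near: a; exact: near_norm_infty_neq0.
  exact: aw_W_large.
apply: cvg_sum_ord => s; apply: cvgM; first exact: cvg_cst.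
apply: (@cvg_limE _ _ _ _ ((- 1) ^+ s * p ^+ 'C(s, 2) * 1 ^+ 3
        / (1 * ((- (kap * p ^+ k.+2)) ^+ s * p ^+ 'C(s, 2)) ^+ 3))).
  by rewrite expr1n mulr1 mul1r.
apply: cvgM; first apply: cvgM.
- exact: cvg_qpoch_large.
- by apply: cvg_exprn; exact: cvg_qpoch_small.
apply: cvgV.
  by rewrite mul1r expf_neq0 // mulf_neq0 // expf_neq0 // oppr_eq0 mulf_neq0.
apply: cvgM; first exact: cvg_qpoch_small.
by apply: cvg_exprn; exact: cvg_qpoch_large.
Unshelve. all: by end_near. Qed.

End AssociatedAskeyWilsonLimit.
(** * The limit of the associated Askey-Wilson polynomials *)

Lemma bin2D m k : 'C(m + k, 2) = ('C(m, 2) + 'C(k, 2) + m * k)%N.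
Proof.
elim: k => [|k IHk]; first by rewrite addn0 muln0 !addn0.
by rewrite addnS !binS IHk !bin1 mulnS; lia.
Qed.

Lemma mulnn_bin2 m : (m * m = 'C(m, 2) + 'C(m, 2) + m)%N.
Proof. by elim: m => // m IHm; rewrite !binS bin1; lia. Qed.

Section AssocAW.
Variables (K : numFieldType) (eps : aw_kind) (kap p sig : K).
Hypothesis kap_neq0 : kap != 0.
Hypothesis p_neq0 : p != 0.
Hypothesis sig_neq0 : sig != 0.
Hypothesis p_generic : forall i : nat, (0 < i)%N -> p ^+ i != 1.
Hypothesis kap_generic : forall i : nat, kap * p ^+ i != 1.
Local Notation oo := (@norm_infty K).
Local Notation e := (kind_shift eps).
Local Notation beta := (kap * p ^+ 2).

(** The coefficient of X^(2 k) in the limit; sig is the scale for which the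
    polynomial is evaluated at sig alpha^2 X^2, as in [cvg_assocAW]. *)
Definition aw_limit_coef n k : K :=
  (beta / (2 * sig)) ^+ (n - k) * p ^+ ((n - k) * (n - k) + (n - k) * k)
  / (qpoch p p (n - k) * qpoch (kap * p ^+ (n + k).+1) p (n - k))
  * \sum_(j < (n - k).+1)
        qpoch (kap * p ^+ (n + k).+1) p j * qpoch (p ^- (n - k)) p j
        / (qpoch p p j * qpoch (kap * p ^+ e) p j) * (p ^+ e / p ^+ k) ^+ j.

(** Each factor of the basis is of order alpha^3, and the constant term is of
    lower order than the coefficient of X^2. *)
Lemma aw_basis_large k a : a != 0 ->
  aw_basis (beta * a) p k \Po ((sig * a ^+ 2) *: 'X^2)
  = a ^+ (3 * k) *: \prod_(i < k)
      ((a^-1 ^+ 3 + beta ^+ 2 * p ^+ (2 * i) * a^-1)%:P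
       - (2 * beta * sig * p ^+ i) *: 'X^2).
Proof.
move=> a0; rewrite /aw_basis rmorph_prod /=.
have -> : a ^+ (3 * k) = \prod_(i < k) a ^+ 3.
  by rewrite prodr_const card_ord exprM.
rewrite -scaler_prod; apply: eq_bigr => i _.
rewrite comp_polyB comp_polyC comp_polyZ comp_polyX scalerBr !scalerA.
congr (_ - _ *: _); last by ring.
by rewrite -mul_polyC -polyCM; congr (_%:P); field; rewrite a0.
Qed.

Lemma prod_aw_limit k : \prod_(i < k) (0%:P - (2 * beta * sig * p ^+ i) *: 'X^2)
  = ((- (2 * beta * sig)) ^+ k * p ^+ 'C(k, 2)) *: 'X^(2 * k) :> {poly K}.
Proof.
move: (2 * beta * sig) => u.
elim: k => [|k IHk]; first by rewrite big_ord0 muln0 !expr0 mul1r scale1r.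
rewrite big_ord_recr IHk /= mulnSr exprD sub0r -scaleNr -!mul_polyC mulrACA.
by rewrite -polyCM expr_bin2S [(- u) ^+ k.+1]exprSr; congr (_%:P * _); ring.
Qed.

(** The part of the k-th coefficient that does not depend on alpha. *)
Definition aw_prefactor n k : K :=
  (2 * beta * sig) ^- n / (qpoch (kap * p ^+ n.+1) p n * qpoch (kap * p) p n)
  * (qpoch (p ^- n) p k * qpoch (kap * p ^+ n.+1) p k * qpoch (kap * p) p k
     / qpoch p p k * p ^+ k).

(** The powers of alpha balance: alpha^(-2 n) from the scaling, alpha^(-n) and
    alpha^(3 n) from the normalisation, alpha^(-3 k) from the denominators and
    alpha^(3 k) from the basis. *)
Lemma assocAW_large n a : a != 0 ->
  (sig^-1 ^+ n / a ^+ (2 * n)) *: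
    (assocAW eps (beta * a) a^-1 a^-1 a^-1 a p n \Po ((sig * a ^+ 2) *: 'X^2))
  = \sum_(k < n.+1)
    (aw_prefactor n k
     * ((qpoch (beta * a) p n / a ^+ n) ^+ 3 * qpoch (kap * p / a) p n
        / ((qpoch (beta * a) p k / a ^+ k) ^+ 3 * qpoch (kap * p / a) p k))
     * aw_W eps (beta * a) a^-1 a^-1 a^-1 a p n k)
    *: \prod_(i < k)
      ((a^-1 ^+ 3 + beta ^+ 2 * p ^+ (2 * i) * a^-1)%:P
       - (2 * beta * sig * p ^+ i) *: 'X^2).
Proof.
move=> a0; rewrite /assocAW comp_polyZ raddf_sum scalerA scaler_sumr /=.
apply: eq_bigr => -[k kn] _ /=.
rewrite comp_polyZ aw_basis_large // !scalerA; congr (_ *: _).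
move: (aw_W _ _ _ _ _ _ _ _ _) => W.
rewrite /aw_norm /aw_prefactor.
have -> : beta * a * a^-1 * a = beta * a by field.
have -> : beta * a * a^-1 * a^-1 * a^-1 * a / p = kap * p / a.
  by field; rewrite p_neq0 a0.
have -> : beta * a * a^-1 * a^-1 * a^-1 * a ^+ 2 * p ^ (n%:Z - 1)
    = kap * p ^+ n.+1.
  have -> : p ^ (n%:Z - 1) = p ^+ n / p by rewrite expfzDr.
  rewrite [p ^+ n.+1]exprS; field.
  by rewrite p_neq0 a0.
have -> : beta * a * a^-1 * a^-1 * a^-1 * a ^+ 2 / p = kap * p.
  by field; rewrite p_neq0 a0.
rewrite /qpochs !big_cons !big_nil !mulr1.
have pp : qpoch p p k != 0.
  by apply: qpoch_neq0 => i _; rewrite -exprS p_generic.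
have kp : qpoch (kap * p) p n != 0.
  by apply: qpoch_neq0 => i _; rewrite -mulrA -exprS.
have kpn : qpoch (kap * p ^+ n.+1) p n != 0.
  by apply: qpoch_neq0 => i _; rewrite -mulrA -exprD.
have beta0 : beta != 0 by rewrite mulf_neq0 ?expf_neq0.
rewrite [(2 * n)%N]mulnC [(3 * k)%N]mulnC !(exprM a).
move: beta beta0 => b b0.
move: (qpoch (b * a) p k) (qpoch (kap * p / a) p k) => X1 X2.
have [->|X1n] := eqVneq X1 0; first by rewrite !(mul0r, mulr0, expr0n, invr0).
have [->|X2n] := eqVneq X2 0; first by rewrite !(mul0r, mulr0, invr0).
have two0 : 2 != 0 :> K by rewrite pnatr_eq0.
rewrite !exprMn !exprVn; field.
by rewrite X1n X2n pp kp kpn !expf_neq0.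
Qed.

(** The right-hand side is the product of the separate limits, in the form in
    which they arise; the left-hand side is its simplification.  Besides the
    factorial identities this is a count of powers of p, made by writing all
    exponents in terms of m k, (m choose 2) and (k choose 2) for m = n - k. *)
Lemma aw_limit_coefE n k : (k <= n)%N ->
  aw_limit_coef n k =
  aw_prefactor n k
  * (((- beta) ^+ n * p ^+ 'C(n, 2)) ^+ 3
     / ((- beta) ^+ k * p ^+ 'C(k, 2)) ^+ 3)
  * (qpoch (kap * p ^+ k.+1) p (n - k) / qpoch (p ^- n) p (n - k)
      / (kap * p ^+ (n + k).+1) ^+ (n - k)
    * \sum_(j < (n - k).+1)
        qpoch (kap * p ^+ (n + k).+1) p j * qpoch (p ^- (n - k)) p j
        / (qpoch p p j * qpoch (kap * p ^+ e) p j) * (p ^+ e / p ^+ k) ^+ j)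
  * ((- (2 * beta * sig)) ^+ k * p ^+ 'C(k, 2)).
Proof.
move=> kn; rewrite /aw_limit_coef /aw_prefactor.
move: (\sum_(_ < _) _) => S.
have [m En] : {m | n = (m + k)%N} by exists (n - k)%N; rewrite subnK.
have nk : (n - k = m)%N by rewrite En addnK.
rewrite nk.
have pX i : p ^+ i != 0 by rewrite expf_neq0.
have pp i : qpoch p p i != 0.
  by apply: qpoch_neq0 => j _; rewrite -exprS p_generic.
have kp i j : qpoch (kap * p ^+ j) p i != 0.
  by apply: qpoch_neq0 => l _; rewrite -mulrA -exprD.
have kp0 i : qpoch (kap * p) p i != 0 by rewrite -[p in kap * p]expr1.
have E1 : qpoch (kap * p ^+ n.+1) p n
    = qpoch (kap * p ^+ n.+1) p k * qpoch (kap * p ^+ (n + k).+1) p m.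
  by rewrite {2}En addnC qpochD -mulrA -exprD.
have E2 : qpoch (kap * p) p n
    = qpoch (kap * p) p k * qpoch (kap * p ^+ k.+1) p m.
  by rewrite En addnC qpochD -mulrA -exprS.
have Q1 : qbin p n k = qpoch p p n / (qpoch p p k * qpoch p p m).
  by rewrite En -qbin_fact // mulfK // mulf_neq0.
have Q2 : qbin p n m = qpoch p p n / (qpoch p p k * qpoch p p m).
  by rewrite En addnC -qbin_fact // [_ k * _]mulrC mulfK // mulf_neq0.
rewrite E1 E2 !qpoch_negX // Q1 Q2.
have X1 : p ^+ 'C(n, 2) = p ^+ 'C(m, 2) * p ^+ 'C(k, 2) * p ^+ (m * k).
  by rewrite En bin2D !exprD.
have X2 i : p ^+ (i * i) = p ^+ 'C(i, 2) ^+ 2 * p ^+ i.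
  by rewrite mulnn_bin2 !exprD expr2.
have X3 : (p ^+ n) ^+ k = p ^+ (m * k) * (p ^+ 'C(k, 2) ^+ 2 * p ^+ k).
  by rewrite -exprM En mulnDl exprD X2.
have X4 : (p ^+ n) ^+ m = p ^+ 'C(m, 2) ^+ 2 * p ^+ m * p ^+ (m * k).
  by rewrite -exprM En mulnDl exprD X2 (mulnC k).
have X5 : (kap * p ^+ (n + k).+1) ^+ m
    = kap ^+ m * (p ^+ 'C(m, 2) ^+ 2 * p ^+ m * p ^+ (m * k) ^+ 2 * p ^+ m).
  rewrite exprMn exprS exprD !exprMn X4 -(exprM p k m) (mulnC k); ring.
rewrite X1 X3 X4 X5 exprD X2.
rewrite -[- beta]mulN1r -[- (2 * beta * sig)]mulN1r expr_div_n.
rewrite ![(_ * _) ^+ n]exprMn ![(_ * _) ^+ m]exprMn ![(_ * _) ^+ k]exprMn.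
have Y (x : K) : x ^+ n = x ^+ m * x ^+ k by rewrite En exprD.
rewrite !Y.
have s2 i : (-1) ^+ i * (-1) ^+ i = 1 :> K by rewrite -expr2 sqrr_sign.
have two0 : 2 != 0 :> K by rewrite pnatr_eq0.
(* The signs of the right-hand side multiply to the square of each sign. *)
rewrite -[LHS]mulr1 -[X in _ * X = _](s2 m) -[LHS]mulr1 -[X in _ * X = _](s2 k).
have kpm := kp m (n + k).+1; have kpk := kp m k.+1; have kpn := kp k n.+1.
move: (qpoch (kap * p ^+ (n + k).+1) p m) kpm => T1 T10.
move: (qpoch (kap * p ^+ k.+1) p m) kpk => T2 T20.
move: (qpoch (kap * p ^+ n.+1) p k) kpn => T3 T30.
move: (p ^+ (m * k)) (pX (m * k)%N) => Z Z0.
have ppn := pp n; have ppm := pp m; have ppk := pp k; have k0 := kp0 k.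
field.
by rewrite Z0 !pX ppn ppm ppk T10 T20 T30 k0 !signr_eq0 !expf_neq0.
Qed.

Theorem cvg_assocAW n : coef_cvg oo
  (fun a => (sig^-1 ^+ n / a ^+ (2 * n)) *:
    (assocAW eps (beta * a) a^-1 a^-1 a^-1 a p n \Po ((sig * a ^+ 2) *: 'X^2)))
  (\sum_(k < n.+1) aw_limit_coef n k *: 'X^(2 * k)).
Proof.
apply: coef_cvg_near.
  near=> a; have a0 : a != 0 by near: a; exact: near_norm_infty_neq0.
  exact: assocAW_large.
apply: coef_cvg_sum => -[k kn] /=; rewrite ltnS in kn.
have beta0 : beta != 0 by rewrite mulf_neq0 ?expf_neq0.
pose W := qpoch (kap * p ^+ k.+1) p (n - k) / qpoch (p ^- n) p (n - k)
      / (kap * p ^+ (n + k).+1) ^+ (n - k)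
    * \sum_(j < (n - k).+1)
        qpoch (kap * p ^+ (n + k).+1) p j * qpoch (p ^- (n - k)) p j
        / (qpoch p p j * qpoch (kap * p ^+ e) p j) * (p ^+ e / p ^+ k) ^+ j.
have -> : aw_limit_coef n k *: 'X^(2 * k) =
  (aw_prefactor n k * (((- beta) ^+ n * p ^+ 'C(n, 2)) ^+ 3 * 1
    / (((- beta) ^+ k * p ^+ 'C(k, 2)) ^+ 3 * 1)) * W)
  *: \prod_(i < k) ((0 ^+ 3 + beta ^+ 2 * p ^+ (2 * i) * 0)%:P
                    - (2 * beta * sig * p ^+ i) *: 'X^2).
  rewrite expr0n /= mulr0n.
  under eq_bigr do rewrite mulr0 addr0.
  rewrite prod_aw_limit scalerA; congr (_ *: _).
  by rewrite aw_limit_coefE // !mulr1 -!mulrA.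
apply: coef_cvgZ.
  apply: cvgM; last exact: cvg_aw_W.
  apply: cvgM; first exact: cvg_cst.
  apply: cvgM; first apply: cvgM.
  - by apply: cvg_exprn; exact: cvg_qpoch_large.
  - exact: cvg_qpoch_small.
  apply: cvgV.
    by rewrite mulr1 expf_neq0 // mulf_neq0 // expf_neq0 // oppr_eq0.
  apply: cvgM; last exact: cvg_qpoch_small.
  by apply: cvg_exprn; exact: cvg_qpoch_large.
apply: (@coef_cvg_prod _ _ _ _
   (fun i a => (a^-1 ^+ 3 + beta ^+ 2 * p ^+ (2 * i) * a^-1)%:P
       - (2 * beta * sig * p ^+ i) *: 'X^2)
   (fun i => (0 ^+ 3 + beta ^+ 2 * p ^+ (2 * i) * 0)%:P
                    - (2 * beta * sig * p ^+ i) *: 'X^2)) => i.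
apply: coef_cvgB; last exact: coef_cvg_cst.
apply: coef_cvgC; apply: cvgD.
  by apply: cvg_exprn; exact: cvg_inv_norm_infty.
by apply: cvgM; [exact: cvg_cst|exact: cvg_inv_norm_infty].
Unshelve. all: by end_near. Qed.

End AssocAW.
(** * Identification of the two families *)

Section BaseInversion.
Variables (K : numFieldType) (c q : K).
Hypothesis c_neq0 : c != 0.
Hypothesis q_neq0 : q != 0.
Hypothesis q_generic : forall i : nat, (0 < i)%N -> q ^+ i != 1.
Hypothesis c_generic : forall i : nat, c * q ^+ i != 1.

Lemma qpoch_inv (a : K) n : a != 0 ->
  qpoch a^-1 q^-1 n = (-1) ^+ n * qpoch a q n / (a ^+ n * q ^+ 'C(n, 2)).
Proof.
move=> a0; elim: n => [|n IHn].
  by rewrite !qpoch0 bin_small // !expr0 !mul1r invr1.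
rewrite !qpochS IHn expr_bin2S exprVn !(exprS a) !(exprS (-1)).
by field; rewrite a0 !expf_neq0.
Qed.

(** Here kap = c, and the scale makes beta / (2 sig) equal to 1. *)
Lemma aw_limit_coef_odd n k : (k <= n)%N ->
  aw_limit_coef Eps1 c q (c * q ^+ 2 / 2) n k
  = lommel_coef c q (n - k) (2 * k).+1.
Proof.
move=> kn; rewrite /aw_limit_coef /lommel_coef /kind_shift.
have -> : (2 * k).+1./2 = k by lia.
have -> : ((n - k) + (2 * k).+1 = (n + k).+1)%N by lia.
have -> : c * q ^+ 2 / (2 * (c * q ^+ 2 / 2)) = 1.
  by field; rewrite c_neq0 q_neq0.
by rewrite expr1n expr0 !mul1r mulr1.
Qed.

(** Here the base is 1/q and kap = q / c.  Inverting the base in all the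
    factorials turns c^-1 into c, and the powers of q that come out change the
    argument of the series from q^(k-1) to q^-k. *)
Lemma aw_limit_coef_even n k : (k <= n)%N ->
  aw_limit_coef Eps2 (q / c) q^-1 (2 * q)^-1 n k
  = lommel_coef c q (n - k) (2 * k).
Proof.
move=> kn; rewrite /aw_limit_coef /lommel_coef /kind_shift.
have -> : (2 * k)./2 = k by lia.
have -> : ((n - k) + (2 * k) = n + k)%N by lia.
have -> : q / c * q^-1 ^+ 2 / (2 * (2 * q)^-1) = c^-1.
  by field; rewrite c_neq0 q_neq0.
have qX i : q ^+ i != 0 by rewrite expf_neq0.
have -> : q / c * q^-1 ^+ (n + k).+1 = (c * q ^+ (n + k))^-1.
  by rewrite exprVn exprS; field; rewrite c_neq0 q_neq0 qX.
have -> : q / c * q^-1 ^+ 1 = c^-1 by rewrite expr1; field; rewrite c_neq0.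
have x0 : c * q ^+ (n + k) != 0 by rewrite mulf_neq0.
have Enk : (n + k = n - k + k + k)%N by lia.
move: (n - k)%N Enk => m Enk.
have pp i : qpoch q q i != 0.
  by apply: qpoch_neq0 => j _; rewrite -exprS q_generic.
have cp i : qpoch c q i != 0 by exact: qpoch_neq0.
have xp i : qpoch (c * q ^+ (n + k)) q i != 0.
  by apply: qpoch_neq0 => j _; rewrite -mulrA -exprD.
rewrite !qpoch_inv //.
have -> : \sum_(j < m.+1) qpoch (c * q ^+ (n + k))^-1 q^-1 j
      * qpoch (q^-1 ^- m) q^-1 j / (qpoch q^-1 q^-1 j * qpoch c^-1 q^-1 j)
      * (q^-1 ^+ 1 / q^-1 ^+ k) ^+ j
  = \sum_(j < m.+1) qpoch (c * q ^+ (n + k)) q j * qpoch (q ^- m) q j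
      / (qpoch q q j * qpoch c q j) * (q ^- k) ^+ j.
  apply: eq_bigr => j _.
  have -> : q^-1 ^- m = (q ^- m)^-1 by rewrite exprVn.
  rewrite !qpoch_inv ?invr_eq0 //.
  rewrite !exprVn expr1 expr_div_n !(exprMn j) !exprVn.
  have -> : (q ^+ (n + k)) ^+ j = (q ^+ m) ^+ j * (q ^+ k) ^+ j ^+ 2.
    by rewrite Enk !exprD !exprMn mulrA.
  by field; rewrite !signr_eq0 !expf_neq0 // pp cp.
rewrite mulrC [RHS]mulrC; congr (_ * _).
rewrite -[LHS]mulr1 -[X in _ * X = _](sqrr_sign K m) !exprVn.
have xpm := xp m; move: (qpoch (c * q ^+ (n + k)) q m) xpm => Y Y0.
have -> : (c * q ^+ (n + k)) ^+ m = c ^+ m * (q ^+ 'C(m, 2) ^+ 2 * q ^+ m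
    * q ^+ (m * k) ^+ 2).
  have Emm : (q ^+ m) ^+ m = q ^+ 'C(m, 2) ^+ 2 * q ^+ m.
    by rewrite -exprM mulnn_bin2 !exprD expr2.
  have Emk : (q ^+ k) ^+ m = q ^+ (m * k) by rewrite -exprM mulnC.
  by rewrite Enk !exprD !exprMn Emm Emk; ring.
rewrite exprD mulnn_bin2 !exprD.
by field; rewrite !signr_eq0 !expf_neq0 // pp Y0.
Qed.

End BaseInversion.

Theorem theorem4p7 (K : numFieldType) (c q : K)
    (c_neq0 : c != 0) (q_neq0 : q != 0)
    (q_generic : forall k : nat, (0 < k)%N -> q ^+ k != 1)
    (c_generic : forall k : nat, c * q ^ (k%:Z - 1) != 1)
    (n : nat) :
  coef_cvg (@norm_infty K)
    (fun alpha => ((2 * q) ^+ n / alpha ^+ (2 * n)) *: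
       (assocAW Eps2 (alpha / (c * q)) alpha^-1 alpha^-1 alpha^-1 alpha q^-1 n
          \Po ((alpha ^+ 2 / (2 * q)) *: 'X^2)))
    (qLommel c q (2 * n))
  /\
  (exists2 L : {poly K},
     coef_cvg (@norm_infty K)
       (fun alpha => ((2 / (c * q ^+ 2)) ^+ n / alpha ^+ (2 * n)) *:
          (assocAW Eps1 (c * q ^+ 2 * alpha) alpha^-1 alpha^-1 alpha^-1
             alpha q n
             \Po ((c * q ^+ 2 * alpha ^+ 2 / 2) *: 'X^2)))
       L
     & qLommel c q (2 * n).+1 = 'X * L).
Proof.
have cq i : c * q ^+ i != 1.
  by have := c_generic i.+1; rewrite intS [1 + _]addrC addrK.
have [even odd] := qLommel_explicit c_neq0 q_neq0 q_generic cq n.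
rewrite even odd; split; last first.
  exists (lommel_odd c q n) => //.
  have sig0 : c * q ^+ 2 / 2 != 0 by rewrite !mulf_neq0 ?invr_eq0 ?expf_neq0.
  have := @cvg_assocAW _ Eps1 _ _ _ c_neq0 q_neq0 sig0 q_generic cq n.
  have -> : \sum_(k < n.+1)
      aw_limit_coef Eps1 c q (c * q ^+ 2 / 2) n k *: 'X^(2 * k)
      = lommel_odd c q n.
    by apply: eq_bigr => -[k kn] _ /=; rewrite aw_limit_coef_odd.
  apply: coef_cvg_near; near=> a.
  by rewrite invf_div [c * q ^+ 2 / 2 * _]mulrAC.
have sig0 : (2 * q)^-1 != 0 by rewrite invr_eq0 mulf_neq0.
have qc0 : q / c != 0 by rewrite mulf_neq0 ?invr_eq0.
have qi0 : q^-1 != 0 by rewrite invr_eq0.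
have qiP i : (0 < i)%N -> q^-1 ^+ i != 1.
  by move=> i0; rewrite exprVn invr_eq1 q_generic.
have kapP i : q / c * q^-1 ^+ i != 1.
  have -> : q / c * q^-1 ^+ i = (c * q ^ (i%:Z - 1))^-1.
    rewrite exprVn expfzDr // -[q ^ (-1)]/(q^-1) -[q ^ i%:Z]/(q ^+ i).
    by field; rewrite c_neq0 q_neq0 expf_neq0.
  by rewrite invr_eq1 c_generic.
have := @cvg_assocAW _ Eps2 _ _ _ qc0 qi0 sig0 qiP kapP n.
have -> : \sum_(k < n.+1)
      aw_limit_coef Eps2 (q / c) q^-1 (2 * q)^-1 n k *: 'X^(2 * k)
      = lommel_even c q n.
  by apply: eq_bigr => -[k kn] _ /=; rewrite aw_limit_coef_even.
apply: coef_cvg_near; near=> a.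
have -> : a / (c * q) = q / c * q^-1 ^+ 2 * a.
  by field; rewrite c_neq0 q_neq0.
by rewrite invrK [_ * a ^+ 2]mulrC.
Unshelve. all: by end_near. Qed.
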